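(* Let $P,A_I,A_O,B_I,B_O,F$ be finite-dimensional Hilbert spaces and let $U:P\otimes A_O\otimes B_O\to A_I\otimes B_I\otimes F$ be a unitary operator representing a pure quantum superchannel with two slots $A$ (input $A_I$, output $A_O$) and $B$ (input $B_I$, output $B_O$), global past $P$ and global future $F$. Then $U$ represents a direct sum of pure combs with two slots $A$ and $B$: there exist orthogonal decompositions $P=P^{A\prec B}\oplus P^{B\prec A}$ and $F=F^{A\prec B}\oplus F^{B\prec A}$ into subspaces, a unitary $U^{A\prec B}:P^{A\prec B}\otimes A_O\otimes B_O\to A_I\otimes B_I\otimes F^{A\prec B}$ representing a quantum comb of $A\prec B$, and a unitary $U^{B\prec A}:P^{B\prec A}\otimes A_O\otimes B_O\to A_I\otimes B_I\otimes F^{B\prec A}$ representing a quantum comb of $B\prec A$, such that $U=U^{A\prec B}\oplus U^{B\prec A}$ (i.e. $U$ restricted to $P^{A\prec B}\otimes A_O\otimes B_O$ equals $U^{A\prec B}$ and restricted to $P^{B\prec A}\otimes A_O\otimes B_O$ equals $U^{B\prec A}$).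
   Context: All Hilbert spaces are finite-dimensional. Choi operator of a map $\mathcal{E}:\mathcal{L}(\mathcal{H}_I)\to\mathcal{L}(\mathcal{H}_O)$: $E=\sum_{i,i'}|i\rangle\langle i'|\otimes\mathcal{E}(|i\rangle\langle i'|)$. Choi vector of an operator $X:\mathcal{H}_I\to\mathcal{H}_O$: $|X\rangle\rangle=\sum_i|i\rangle\otimes X|i\rangle$. Link product: $E*G=\mathrm{Tr}_1[(E\otimes 1_2)(1_0\otimes G^{T_1})]$ for $E\in\mathcal{L}(\mathcal{H}_0\otimes\mathcal{H}_1)$, $G\in\mathcal{L}(\mathcal{H}_1\otimes\mathcal{H}_2)$. A two-slot supermap $[\mathcal{L}(A_I)\to\mathcal{L}(A_O)]\otimes[\mathcal{L}(B_I)\to\mathcal{L}(B_O)]\to[\mathcal{L}(P)\to\mathcal{L}(F)]$ is given by a Choi operator $W\in\mathcal{L}(P\otimes A_I\otimes A_O\otimes B_I\otimes B_O\otimes F)$, acting on inputs (possibly with auxiliary spaces) by $W*(E_A\otimes E_B)$. It is a quantum superchannel if for all auxiliary spaces $A_I',A_O',B_I',B_O'$ and all CPTP maps $\mathcal{E}_A:\mathcal{L}(A_I\otimes A_I')\to\mathcal{L}(A_O\otimes A_O')$, $\mathcal{E}_B:\mathcal{L}(B_I\otimes B_I')\to\mathcal{L}(B_O\otimes B_O')$, $W*(E_A\otimes E_B)$ is the Choi operator of a CPTP map $\mathcal{L}(P\otimes A_I'\otimes B_I')\to\mathcal{L}(F\otimes A_O'\otimes B_O')$; it is pure if this output is a unitary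 channel whenever $\mathcal{E}_A,\mathcal{E}_B$ are unitary channels. A unitary $U:P\otimes A_O\otimes B_O\to A_I\otimes B_I\otimes F$ represents the supermap with Choi operator $W=|U\rangle\rangle\langle\langle U|$ (pure superchannels are exactly those represented this way). A quantum comb of $A\prec B$ is a two-slot superchannel realizable by a causally ordered circuit using slot $A$ before slot $B$; equivalently its Choi operator $W\ge0$ satisfies $\mathrm{Tr}_F W=1^{B_O}\otimes R_2$, $\mathrm{Tr}_{B_I}R_2=1^{A_O}\otimes R_1$, $\mathrm{Tr}_{A_I}R_1=1^{P}$ for some operators $R_2,R_1$. A quantum comb of $B\prec A$ is defined with the roles of $A$ and $B$ exchanged. *)

(* Defs.v *)
(* Finite-dimensional Hilbert spaces are C^T for a finite
   basis type T (T : finType); the scalar field C is an arbitrary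
   numClosedFieldType (e.g. complex numbers R[i], algC).  An operator
   X : H_S -> H_T is represented by its matrix entries X t s = <t|X|s>. *)
From HB Require Import structures.
From mathcomp Require Import all_boot all_order all_algebra.
Set Implicit Arguments. Unset Strict Implicit. Unset Printing Implicit Defensive.
Import Order.TTheory GRing.Theory Num.Theory.
Local Open Scope ring_scope.

Section QDefs.
Variable C : numClosedFieldType.

Definition op (T S : finType) := T -> S -> C.
Arguments op (T S)%_type_scope.

Definition op_eq (T S : finType) (X Y : op T S) := forall t s, X t s = Y t s.
Definition adj (T S : finType) (X : op T S) : op S T := fun s t => (X t s)^*.
Definition mulop (T S R : finType) (X : op T S) (Y : op S R) : op T R :=
  fun t r => \sum_(s : S) X t s * Y s r.
Definition idop (T : finType) : op T T := fun t t' => (t == t')%:R.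
Definition trace (T : finType) (X : op T T) : C := \sum_(t : T) X t t.

Definition isometry (T S : finType) (X : op T S) := op_eq (mulop (adj X) X) (@idop S).
Definition unitary (T S : finType) (X : op T S) :=
  isometry X /\ op_eq (mulop X (adj X)) (@idop T).
Definition psd (T : finType) (X : op T T) :=
  forall v : T -> C, 0 <= \sum_(t : T) \sum_(t' : T) (v t)^* * X t t' * v t'.

Definition qmap (I O : finType) := op I I -> op O O.
Arguments qmap (I O)%_type_scope.
Definition linear_qmap (I O : finType) (M : qmap I O) :=
  forall (a : C) (X Y : op I I),
    op_eq (M (fun i i' => a * X i i' + Y i i')) (fun o o' => a * M X o o' + M Y o o').
(* id_K (x) M, acting blockwise *)
Definition ampl (I O : finType) (M : qmap I O) (K : finType) (X : op (K * I) (K * I))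
  : op (K * O) (K * O) :=
  fun ko ko' => M (fun i i' => X (ko.1, i) (ko'.1, i')) ko.2 ko'.2.
Definition CP (I O : finType) (M : qmap I O) :=
  forall (K : finType) (X : op (K * I) (K * I)), psd X -> psd (ampl M X).
Definition TP (I O : finType) (M : qmap I O) := forall X, trace (M X) = trace X.
Definition CPTP (I O : finType) (M : qmap I O) := [/\ linear_qmap M, CP M & TP M].
Definition unitary_channel (I O : finType) (M : qmap I O) :=
  exists V : op O I, unitary V /\ forall X, op_eq (M X) (mulop (mulop V X) (adj V)).

(* Choi operator E = sum_{i,i'} |i><i'| (x) E(|i><i'|), on H_I (x) H_O *)
Definition choi (I O : finType) (M : qmap I O) : op (I * O) (I * O) :=
  fun x y => M (fun i i' => ((i == x.1) && (i' == y.1))%:R) x.2 y.2.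
Definition choi_of_CPTP (I O : finType) (J : op (I * O) (I * O)) :=
  exists M : qmap I O, CPTP M /\ op_eq (choi M) J.
Definition choi_of_unitary_channel (I O : finType) (J : op (I * O) (I * O)) :=
  exists M : qmap I O, unitary_channel M /\ op_eq (choi M) J.

(* link product E * G = Tr_1[(E (x) 1_2)(1_0 (x) G^{T_1})] *)
Definition link (X0 X1 X2 : finType) (E : op (X0 * X1) (X0 * X1))
  (G : op (X1 * X2) (X1 * X2)) : op (X0 * X2) (X0 * X2) :=
  fun a b => \sum_(x1 : X1) \sum_(y1 : X1) E (a.1, x1) (b.1, y1) * G (x1, a.2) (y1, b.2).

(* Choi operator of a two-slot supermap lives on P AI AO BI BO F *)
Definition op6 (P AI AO BI BO F : finType) :=
  op (P * AI * AO * BI * BO * F) (P * AI * AO * BI * BO * F).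

(* W * (E_A (x) E_B), with E_A on (AI AI') (AO AO'), E_B on (BI BI') (BO BO');
   the result is read as an operator on (P AI' BI') (x) (F AO' BO'). *)
Definition sc_apply (P AI AO BI BO F AI' AO' BI' BO' : finType)
  (W : op6 P AI AO BI BO F)
  (EA : op ((AI * AI') * (AO * AO')) ((AI * AI') * (AO * AO')))
  (EB : op ((BI * BI') * (BO * BO')) ((BI * BI') * (BO * BO')))
  : op ((P * AI' * BI') * (F * AO' * BO')) ((P * AI' * BI') * (F * AO' * BO')) :=
  let E : op ((P * F) * ((AI * AO) * (BI * BO))) ((P * F) * ((AI * AO) * (BI * BO))) :=
    fun x y =>
      let '((p, f), ((ai, ao), (bi, bo))) := x in
      let '((q, g), ((ci, co), (di, do_))) := y in
      W (p, ai, ao, bi, bo, f) (q, ci, co, di, do_, g) in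
  let G : op (((AI * AO) * (BI * BO)) * ((AI' * AO') * (BI' * BO')))
             (((AI * AO) * (BI * BO)) * ((AI' * AO') * (BI' * BO'))) :=
    fun x y =>
      let '(((ai, ao), (bi, bo)), ((ai', ao'), (bi', bo'))) := x in
      let '(((ci, co), (di, do_)), ((ci', co'), (di', do'))) := y in
      EA ((ai, ai'), (ao, ao')) ((ci, ci'), (co, co'))
      * EB ((bi, bi'), (bo, bo')) ((di, di'), (do_, do')) in
  let L := link E G in
  fun x y =>
    let '((p, ai', bi'), (f, ao', bo')) := x in
    let '((q, ci', di'), (g, co', do')) := y in
    L ((p, f), ((ai', ao'), (bi', bo'))) ((q, g), ((ci', co'), (di', do'))).

Definition superchannel (P AI AO BI BO F : finType) (W : op6 P AI AO BI BO F) :=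
  forall (AI' AO' BI' BO' : finType)
         (EA : qmap (AI * AI') (AO * AO')) (EB : qmap (BI * BI') (BO * BO')),
    CPTP EA -> CPTP EB -> choi_of_CPTP (sc_apply W (choi EA) (choi EB)).

Definition pure_superchannel (P AI AO BI BO F : finType) (W : op6 P AI AO BI BO F) :=
  superchannel W /\
  forall (AI' AO' BI' BO' : finType)
         (EA : qmap (AI * AI') (AO * AO')) (EB : qmap (BI * BI') (BO * BO')),
    unitary_channel EA -> unitary_channel EB ->
    choi_of_unitary_channel (sc_apply W (choi EA) (choi EB)).

(* W = |U>><<U| for U : P AO BO -> AI BI F, reordered to P AI AO BI BO F *)
Definition choi_vec_op (P AI AO BI BO F : finType) (U : op (AI * BI * F) (P * AO * BO))
  : op6 P AI AO BI BO F :=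
  fun x y =>
    let '(p, ai, ao, bi, bo, f) := x in
    let '(q, ci, co, di, do_, g) := y in
    U (ai, bi, f) (p, ao, bo) * (U (ci, di, g) (q, co, do_))^*.

(* quantum comb of A < B (Choi-operator characterization) *)
Definition comb_AB (P AI AO BI BO F : finType) (W : op6 P AI AO BI BO F) :=
  psd W /\
  exists (R2 : op (P * AI * AO * BI) (P * AI * AO * BI)) (R1 : op (P * AI) (P * AI)),
  [/\ forall p ai ao bi bo q ci co di do_,
        \sum_(f : F) W (p, ai, ao, bi, bo, f) (q, ci, co, di, do_, f)
        = (bo == do_)%:R * R2 (p, ai, ao, bi) (q, ci, co, di),
      forall p ai ao q ci co,
        \sum_(bi : BI) R2 (p, ai, ao, bi) (q, ci, co, bi) = (ao == co)%:R * R1 (p, ai) (q, ci)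
    & forall p q, \sum_(ai : AI) R1 (p, ai) (q, ai) = (p == q)%:R].

Definition comb_BA (P AI AO BI BO F : finType) (W : op6 P AI AO BI BO F) :=
  comb_AB (fun (x y : P * BI * BO * AI * AO * F) =>
    let '(p, bi, bo, ai, ao, f) := x in
    let '(q, di, do_, ci, co, g) := y in
    W (p, ai, ao, bi, bo, f) (q, ci, co, di, do_, g)).

(* V1 : H_1 -> H, V2 : H_2 -> H isometries onto orthogonal complementary subspaces *)
Definition orth_decomp (T S1 S2 : finType) (V1 : op T S1) (V2 : op T S2) :=
  [/\ isometry V1, isometry V2,
      op_eq (mulop (adj V1) V2) (fun _ _ => 0)
    & op_eq (fun t t' => mulop V1 (adj V1) t t' + mulop V2 (adj V2) t t') (@idop T)].

(* U (V (x) 1_AO (x) 1_BO) = (1_AI (x) 1_BI (x) W) U1, i.e. U restricted to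
   P1 (x) AO (x) BO is U1 : P1 AO BO -> AI BI F1 *)
Definition restricts (P AO BO AI BI F P1 F1 : finType)
  (U : op (AI * BI * F) (P * AO * BO)) (V : op P P1) (W : op F F1)
  (U1 : op (AI * BI * F1) (P1 * AO * BO)) :=
  forall ai bi f q ao bo,
    \sum_(p : P) U (ai, bi, f) (p, ao, bo) * V p q
    = \sum_(g : F1) W f g * U1 (ai, bi, g) (q, ao, bo).

End QDefs.
Arguments op C (T S)%_type_scope.
Arguments qmap C (I O)%_type_scope.

(* Main.v *)
(** Testing the superchannel on measure-and-prepare channels without auxiliary
    systems shows that the Heisenberg images U^*(X (x) 1 (x) 1)U of observables
    on A_I act on P (x) B_O only, those of observables on B_I act on P (x) A_O
    only, and that products of the two contain no term that is traceless on both
    A_O and B_O.  Hence, writing N_A (resp. N_B) for the operators on P that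
    multiply the traceless part on B_O (resp. A_O), N_A and N_B annihilate each
    other.  The space R spanned by the ranges of N_A is invariant under all
    coefficients on P: on R the B_I-observables do not depend on A_O, on its
    complement the A_I-observables do not depend on B_O.  The projection onto R
    commutes with the images of L(A_I) and L(B_I), so U carries it to
    1 (x) 1 (x) Q_F, which yields the decomposition of F. *)
Require Import Defs.
From HB Require Import structures.
From mathcomp Require Import all_boot all_order all_algebra.
From mathcomp Require Import spectral ring.
Set Implicit Arguments. Unset Strict Implicit. Unset Printing Implicit Defensive.
Import Order.TTheory GRing.Theory Num.Theory.
Local Open Scope ring_scope.
Local Open Scope sesquilinear_scope.

(** * Orthogonal decompositions *)

Section Matrices.
Variable C : numClosedFieldType.

Lemma adjmxM m n p (A : 'M[C]_(m, n)) (B : 'M[C]_(n, p)) :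
  (A *m B) ^t* = B ^t* *m A ^t*.
Proof. by rewrite trmx_mul map_mxM. Qed.

Lemma adjmxB m n (A B : 'M[C]_(m, n)) : (A - B) ^t* = A ^t* - B ^t*.
Proof. by apply/matrixP => i j; rewrite !mxE rmorphB. Qed.

Lemma adjmx0 m n : (0 : 'M[C]_(m, n)) ^t* = 0.
Proof. by rewrite trmx0 map_mx0. Qed.

Lemma adjmx_sum m n (I : finType) (A : I -> 'M[C]_(m, n)) :
  (\sum_i A i) ^t* = \sum_i (A i) ^t*.
Proof.
apply/matrixP => i j; rewrite !mxE !summxE rmorph_sum.
by apply: eq_bigr => k _; rewrite !mxE.
Qed.

Lemma adjmx_natZ m n (b : nat) (A : 'M[C]_(m, n)) : (b%:R *: A) ^t* = b%:R *: A ^t*.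
Proof. by apply/matrixP => i j; rewrite !mxE rmorphM rmorph_nat. Qed.

Definition decomp_mx n p q (V1 : 'M[C]_(n, p)) (V2 : 'M[C]_(n, q)) :=
  [/\ V1 ^t* *m V1 = 1%:M, V2 ^t* *m V2 = 1%:M, V1 ^t* *m V2 = 0
    & V1 *m V1 ^t* + V2 *m V2 ^t* = 1%:M].

Lemma orthonormal_row_basis m n (A : 'M[C]_(m, n)) :
  exists r (S : 'M[C]_(r, n)), S *m S ^t* = 1%:M /\ (S :=: A)%MS.
Proof.
exists _, (schmidt (row_base A)); split.
  by apply/unitarymxP/schmidt_unitarymx; rewrite rank_leq_col.
by apply: eqmx_trans (eq_row_base _); apply: eqmx_schmidt_free; rewrite row_base_free.
Qed.

(** Gram-Schmidt on the rows of [N ^t*] and on the left kernel of [N] gives the adjoints of [V2] and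
    [V1]. The factor [Z] records that the range of [V2] is no larger than that of [N]. *)
Lemma range_decomp n k (N : 'M[C]_(n, k)) :
  exists p q (V1 : 'M[C]_(n, p)) (V2 : 'M[C]_(n, q)) (Z : 'M[C]_(k, q)),
    [/\ decomp_mx V1 V2, V1 ^t* *m N = 0 & V2 = N *m Z].
Proof.
have [r [S [SS eS]]] := orthonormal_row_basis (N ^t*).
have [s [T [TT eT]]] := orthonormal_row_basis (kermx N).
have TN : T *m N = 0 by apply/sub_kermxP; rewrite eT.
have [Z SZ] : exists Z, S = Z *m N ^t* by apply/submxP; rewrite eS.
have [Y NY] : exists Y, N ^t* = Y *m S by apply/submxP; rewrite eS.
have V2N : S ^t* = N *m Z ^t* by rewrite SZ adjmxM trmxCK.
have NV2 : N = S ^t* *m Y ^t* by rewrite -adjmxM -NY trmxCK.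
exists _, _, (T ^t*), (S ^t*), (Z ^t*); split; rewrite ?trmxCK //.
have TS : T *m S ^t* = 0 by rewrite V2N mulmxA TN mul0mx.
split; rewrite ?trmxCK //.
(* [E] is the defect of the resolution of the identity. It annihilates [N], so its rows lie in the
   span of [T]; being orthogonal to [T] as well, it vanishes. *)
pose E := 1%:M - T ^t* *m T - S ^t* *m S.
have EN : E *m N = 0.
  rewrite /E !mulmxBl mul1mx -!mulmxA TN mulmx0 subr0 {2}NV2.
  by rewrite [S *m _]mulmxA SS mul1mx -NV2 subrr.
have [D ED] : exists D, E = D *m T by apply/submxP; rewrite eT; apply/sub_kermxP.
have ET : E *m T ^t* = 0.
  rewrite /E !mulmxBl mul1mx -!mulmxA TT mulmx1 subrr.
  have -> : S *m T ^t* = 0 by rewrite -[S]trmxCK -adjmxM TS adjmx0.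
  by rewrite mulmx0 subr0.
have E0 : E = 0 by rewrite ED; move: ET; rewrite ED -mulmxA TT mulmx1 => ->; rewrite mul0mx.
by move: E0; rewrite /E -addrA -opprD => /eqP; rewrite subr_eq0 => /eqP ->.
Qed.

(** Placing all [A k] side by side in one matrix reduces this to [range_decomp]. The last clause
    allows an annihilation of [V2] to be checked on the generators [A k] alone. *)
Lemma family_range_decomp n (K : finType) (A : K -> 'M[C]_n) :
  exists p q (V1 : 'M[C]_(n, p)) (V2 : 'M[C]_(n, q)),
    [/\ decomp_mx V1 V2, forall k, V1 ^t* *m A k = 0
      & forall r (B : 'M[C]_(r, n)), (forall k, B *m A k = 0) -> B *m V2 = 0].
Proof.
pose N := \matrix_(i < n, j < #|{: K * 'I_n}|) A (enum_val j).1 i (enum_val j).2.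
have entry r (B : 'M[C]_(r, n)) i j :
    (B *m N) i j = (B *m A (enum_val j).1) i (enum_val j).2.
  by rewrite !mxE; apply: eq_bigr => l _; rewrite mxE.
have [p [q [V1 [V2 [Z [dV V1N V2N]]]]]] := range_decomp N.
exists p, q, V1, V2; split=> // [k|r B BA].
  apply/matrixP => i l; move/matrixP/(_ i (enum_rank (k, l))): V1N.
  by rewrite entry enum_rankK !mxE.
rewrite V2N mulmxA; have -> : B *m N = 0 by apply/matrixP => i j; rewrite entry BA !mxE.
by rewrite mul0mx.
Qed.

(** With vanishing off-diagonal blocks, both products equal the compression of [X] to the range of
    [V2]. *)
Lemma decomp_mx_commute n p q (V1 : 'M[C]_(n, p)) (V2 : 'M[C]_(n, q)) (X : 'M[C]_n) :
  decomp_mx V1 V2 -> V1 ^t* *m X *m V2 = 0 -> V2 ^t* *m X *m V1 = 0 ->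
  V2 *m V2 ^t* *m X = X *m (V2 *m V2 ^t*).
Proof.
case=> _ _ _ V12 X12 X21.
transitivity (V2 *m V2 ^t* *m X *m (V2 *m V2 ^t*)).
  rewrite -[LHS]mulmx1 -V12 mulmxDr -[RHS]add0r; congr (_ + _).
  by rewrite -!mulmxA [X *m _]mulmxA [V2 ^t* *m _]mulmxA [V2 ^t* *m _]mulmxA X21 mul0mx mulmx0.
rewrite -[in RHS](mul1mx X) -V12 mulmxDl mulmxDl -[LHS]add0r; congr (_ + _).
by rewrite -!mulmxA [X *m _]mulmxA [V1 ^t* *m _]mulmxA [V1 ^t* *m _]mulmxA X12 mul0mx mulmx0.
Qed.

Lemma projection_decomp n (Q : 'M[C]_n) : Q *m Q = Q -> Q ^t* = Q ->
  exists p q (V1 : 'M[C]_(n, p)) (V2 : 'M[C]_(n, q)),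
    decomp_mx V1 V2 /\ V2 *m V2 ^t* = Q.
Proof.
move=> QQ aQ; have [p [q [V1 [V2 [Z [dV V1Q V2Q]]]]]] := range_decomp Q.
exists p, q, V1, V2; split=> //.
have QV1 : Q *m V1 = 0 by rewrite -[V1]trmxCK -{1}aQ -adjmxM V1Q adjmx0.
have QV2 : Q *m V2 = V2 by rewrite V2Q mulmxA QQ.
case: dV => _ _ _ V12.
by rewrite -[RHS]mulmx1 -V12 mulmxDr !mulmxA QV1 mul0mx add0r QV2.
Qed.

Lemma decomp_mx_full n : decomp_mx (1%:M : 'M[C]_n) (0 : 'M[C]_(n, 0)).
Proof.
have a1 : (1%:M : 'M[C]_n) ^t* = 1%:M by rewrite trmx1 map_mx1.
split; rewrite ?a1 ?mulmx1 ?mulmx0 ?mul0mx ?addr0 //.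
by apply/matrixP => -[].
Qed.

Lemma decomp_mxC n p q (V1 : 'M[C]_(n, p)) (V2 : 'M[C]_(n, q)) :
  decomp_mx V1 V2 -> decomp_mx V2 V1.
Proof.
case=> h1 h2 h3 h4; split; rewrite // 1?addrC //.
by rewrite -[V1]trmxCK -adjmxM h3 adjmx0.
Qed.

End Matrices.

(** * Operators as families of blocks from P to F *)

Section Blocks.
Variable C : numClosedFieldType.

Section Gram.
Variables (E T : finType) (m n : nat) (u : E -> T -> 'M[C]_(m, n)).

(** For U the sum of |e><t| tensor [u e t], this is the (t, t') block of the Heisenberg image U^*
    (|e><e'| tensor 1) U, an operator on P. *)
Definition gram e e' t t' : 'M[C]_n := (u e t) ^t* *m u e' t'.

Definition block_isometry := forall t t', \sum_e gram e e t t' = (t == t')%:R%:M.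
Definition block_coisometry :=
  forall e e', \sum_t u e t *m (u e' t) ^t* = (e == e')%:R%:M.

Lemma gram_adj e e' t t' : (gram e e' t t') ^t* = gram e' e t' t.
Proof. by rewrite /gram adjmxM trmxCK. Qed.

(** U U^* = 1 makes the Heisenberg map multiplicative, so matrix units keep their product rule. *)
Lemma gram_mul e1 e2 e3 e4 t t' : block_coisometry ->
  \sum_s gram e1 e2 t s *m gram e3 e4 s t' = (e2 == e3)%:R *: gram e1 e4 t t'.
Proof.
move=> co.
under eq_bigr do rewrite /gram mulmxA -[_ *m _ *m _ ^t*]mulmxA.
by rewrite -mulmx_suml -mulmx_sumr co mul_mx_scalar -scalemxAl.
Qed.

(* A projection commuting with U^*(L(E) (x) 1)U is carried by U to 1 (x) QF. *)
Lemma gram_commutant (Q : 'M[C]_n) (e0 : E) : block_coisometry ->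
  (forall e e' t t', Q *m gram e e' t t' = gram e e' t t' *m Q) ->
  Q *m Q = Q -> Q ^t* = Q ->
  exists QF : 'M[C]_m,
    [/\ QF *m QF = QF, QF ^t* = QF & forall e t, QF *m u e t = u e t *m Q].
Proof.
(* [QF] is the diagonal block of U Q U^* at [e0]; since [Q] commutes with the images of all matrix
   units, every other choice of [e0] would give the same block. *)
move=> co cQ QQ aQ; pose QF := \sum_t u e0 t *m Q *m (u e0 t) ^t*.
have QFu e t : QF *m u e t = u e t *m Q.
  rewrite mulmx_suml.
  have step s : u e0 s *m Q *m (u e0 s) ^t* *m u e t
                = u e0 s *m (u e0 s) ^t* *m (u e t *m Q).
    by rewrite -!mulmxA -/(gram e0 e s t) cQ /gram !mulmxA.
  by under eq_bigr do rewrite step; rewrite -mulmx_suml co eqxx mul1mx.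
exists QF; split => //.
- rewrite {2}/QF mulmx_sumr; apply: eq_bigr => s _.
  by rewrite !mulmxA QFu -[_ *m Q *m Q]mulmxA QQ.
- rewrite adjmx_sum; apply: eq_bigr => s _.
  by rewrite !adjmxM trmxCK aQ !mulmxA.
Qed.

End Gram.

(** The projection onto the range of [W] that appears between the two factors is carried through [u]
    to the projection onto the range of [V], which the final [V] absorbs. *)
Lemma compression_gram (E T : finType) m n f p (u : E -> T -> 'M[C]_(m, n))
    (V : 'M[C]_(n, p)) (W : 'M[C]_(m, f)) e e' t t' :
  V ^t* *m V = 1%:M ->
  (forall e t, u e t *m (V *m V ^t*) = W *m W ^t* *m u e t) ->
  gram (fun e t => W ^t* *m u e t *m V) e e' t t' = V ^t* *m gram u e e' t t' *m V.
Proof.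
move=> VV uVW; rewrite /gram !adjmxM trmxCK !mulmxA -[_ *m W *m W ^t*]mulmxA.
rewrite -[_ *m (W *m W ^t*) *m _]mulmxA -uVW !mulmxA.
by rewrite -[_ *m V ^t* *m V]mulmxA VV mulmx1.
Qed.

Lemma compression_isometry (E T : finType) m n f p (u : E -> T -> 'M[C]_(m, n))
    (V : 'M[C]_(n, p)) (W : 'M[C]_(m, f)) :
  V ^t* *m V = 1%:M ->
  (forall e t, u e t *m (V *m V ^t*) = W *m W ^t* *m u e t) ->
  block_isometry u -> block_isometry (fun e t => W ^t* *m u e t *m V).
Proof.
move=> VV uVW iso t t'; under eq_bigr do rewrite compression_gram //.
by rewrite -mulmx_suml -mulmx_sumr iso mul_mx_scalar -scalemxAl VV scalemx1.
Qed.

Lemma compression_coisometry (E T : finType) m n f p (u : E -> T -> 'M[C]_(m, n))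
    (V : 'M[C]_(n, p)) (W : 'M[C]_(m, f)) :
  W ^t* *m W = 1%:M ->
  (forall e t, u e t *m (V *m V ^t*) = W *m W ^t* *m u e t) ->
  block_coisometry u -> block_coisometry (fun e t => W ^t* *m u e t *m V).
Proof.
move=> WW uVW co e e'.
have step t : W ^t* *m u e t *m V *m (W ^t* *m u e' t *m V) ^t*
              = W ^t* *m (u e t *m (u e' t) ^t*) *m W.
  rewrite !adjmxM trmxCK !mulmxA -[_ *m V *m V ^t*]mulmxA -[_ *m u e t *m _]mulmxA.
  by rewrite uVW !mulmxA WW mul1mx.
under eq_bigr do rewrite step.
by rewrite -mulmx_suml -mulmx_sumr co mul_mx_scalar -scalemxAl WW scalemx1.
Qed.

(** The comb conditions for A before B, read on Gram blocks: up to transposition these are the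
    blocks of the partial trace over F of the Choi operator. *)
Definition comb_blocks (AI BI AO BO : finType) m n
    (u : AI * BI -> AO * BO -> 'M[C]_(m, n)) :=
  exists (R2 : AI -> AI -> BI -> BI -> AO -> AO -> 'M[C]_n) (R1 : AI -> AI -> 'M[C]_n),
  [/\ forall c a d b x x' y y',
        gram u (c, d) (a, b) (x, y) (x', y') = (y == y')%:R *: R2 c a d b x x',
      forall c a x x', \sum_b R2 c a b b x x' = (x == x')%:R *: R1 c a
    & \sum_a R1 a a = 1%:M].

Definition swap_blocks (AI BI AO BO : finType) m n
    (u : AI * BI -> AO * BO -> 'M[C]_(m, n)) : BI * AI -> BO * AO -> 'M[C]_(m, n) :=
  fun e t => u (e.2, e.1) (t.2, t.1).

End Blocks.

(** * The causal decomposition *)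

Section Causal.
Variable C : numClosedFieldType.

Lemma sum_deltaZ (I : finType) m n (i0 : I) (X : I -> 'M[C]_(m, n)) :
  \sum_i (i == i0)%:R *: X i = X i0.
Proof.
rewrite (bigD1 i0) //= eqxx scale1r big1 ?addr0 // => i /negPf ->.
by rewrite scale0r.
Qed.

Variables (AI BI AO BO : finType) (m n : nat).
Variables (u : AI * BI -> AO * BO -> 'M[C]_(m, n)) (x0 : AO) (y0 : BO).
Hypotheses (iso : block_isometry u) (co : block_coisometry u).
Local Notation G := (gram u).

(** Subtracting the block at [y0] isolates what is not a multiple of the identity on B_O. That
    remainder must be the identity on A_O, so no term is nontrivial on both outputs. *)
Hypothesis no_AB_term : forall c a d b x x' y y',
  G (c, d) (a, b) (x, y) (x', y') - (y == y')%:R *: G (c, d) (a, b) (x, y0) (x', y0)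
  = (x == x')%:R *: (G (c, d) (a, b) (x0, y) (x0, y')
                     - (y == y')%:R *: G (c, d) (a, b) (x0, y0) (x0, y0)).
Hypothesis no_B_term : forall d b y y',
  \sum_a G (a, d) (a, b) (x0, y) (x0, y')
  = (y == y')%:R *: \sum_a G (a, d) (a, b) (x0, y0) (x0, y0).
Hypothesis no_A_term : forall c a x x',
  \sum_b G (c, b) (a, b) (x, y0) (x', y0)
  = (x == x')%:R *: \sum_b G (c, b) (a, b) (x0, y0) (x0, y0).

(* [alpha c a] and [beta d b] are the Heisenberg images of |c><a| on A_I and of
   |d><b| on B_I, cut into operators on P by the matrix units of B_O, resp. A_O. *)
Let alpha c a y y' := \sum_b G (c, b) (a, b) (x0, y) (x0, y').
Let beta d b x x' := \sum_a G (a, d) (a, b) (x, y0) (x', y0).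

(** Summing [no_AB_term] over the B_I index leaves only blocks at [y0] to control, and [no_A_term]
    does that: the image of an A_I observable is the identity on A_O. *)
Let alphaE c a x x' y y' :
  \sum_b G (c, b) (a, b) (x, y) (x', y') = (x == x')%:R *: alpha c a y y'.
Proof.
have /eqP : \sum_b (G (c, b) (a, b) (x, y) (x', y')
    - (y == y')%:R *: G (c, b) (a, b) (x, y0) (x', y0))
  = \sum_b (x == x')%:R *: (G (c, b) (a, b) (x0, y) (x0, y')
                     - (y == y')%:R *: G (c, b) (a, b) (x0, y0) (x0, y0)).
  by apply: eq_bigr => b _; rewrite no_AB_term.
rewrite -scaler_sumr !sumrB -!scaler_sumr no_A_term subr_eq => /eqP ->.
by rewrite scalerBr !scalerA [_%:R * _]mulrC subrK.
Qed.

Let betaE d b x x' y y' :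
  \sum_a G (a, d) (a, b) (x, y) (x', y') = (y == y')%:R *: beta d b x x'.
Proof.
have /eqP : \sum_a (G (a, d) (a, b) (x, y) (x', y')
    - (y == y')%:R *: G (a, d) (a, b) (x, y0) (x', y0))
  = \sum_a (x == x')%:R *: (G (a, d) (a, b) (x0, y) (x0, y')
                     - (y == y')%:R *: G (a, d) (a, b) (x0, y0) (x0, y0)).
  by apply: eq_bigr => a _; rewrite no_AB_term.
rewrite -scaler_sumr !sumrB -!scaler_sumr no_B_term subrr scaler0.
by rewrite subr_eq add0r => /eqP.
Qed.

(** The matrix unit |c,d><a,b| is the product of |c><a| on A_I and |d><b| on B_I. In the product of
    the images the intermediate sum collapses, as one factor is the identity on A_O and the other on
    B_O. *)
Let gram_alpha_beta c a d b x x' y y' :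
  G (c, d) (a, b) (x, y) (x', y') = alpha c a y y' *m beta d b x x'.
Proof.
transitivity (\sum_s (\sum_b' G (c, b') (a, b') (x, y) s)
                     *m (\sum_a' G (a', d) (a', b) s (x', y'))).
  under eq_bigr do rewrite mulmx_suml.
  rewrite exchange_big /=.
  under eq_bigr => b' _ do under eq_bigr do rewrite mulmx_sumr.
  under eq_bigr => b' _ do rewrite exchange_big /=.
  under eq_bigr => b' _ do
    under eq_bigr do rewrite gram_mul // xpair_eqE andbC -mulnb natrM -scalerA.
  under eq_bigr do rewrite -scaler_sumr.
  rewrite sum_deltaZ.
  by under eq_bigr do rewrite eq_sym; rewrite sum_deltaZ.
transitivity (\sum_i \sum_j (i == x)%:R *: ((j == y')%:R *:
                (alpha c a y j *m beta d b i x'))).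
  rewrite pair_bigA /=; apply: eq_bigr => -[i j] _ /=.
  by rewrite alphaE betaE -scalemxAl -scalemxAr eq_sym.
under eq_bigr do rewrite -scaler_sumr.
by rewrite sum_deltaZ sum_deltaZ.
Qed.

(** The same factorization in the opposite order; comparing the two shows that [alpha] and [beta]
    commute. *)
Let gram_beta_alpha c a d b x x' y y' :
  G (c, d) (a, b) (x, y) (x', y') = beta d b x x' *m alpha c a y y'.
Proof.
transitivity (\sum_s (\sum_a' G (a', d) (a', b) (x, y) s)
                     *m (\sum_b' G (c, b') (a, b') s (x', y'))).
  under eq_bigr do rewrite mulmx_suml.
  rewrite exchange_big /=.
  under eq_bigr => b' _ do under eq_bigr do rewrite mulmx_sumr.
  under eq_bigr => b' _ do rewrite exchange_big /=.
  under eq_bigr => b' _ do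
    under eq_bigr do rewrite gram_mul // xpair_eqE -mulnb natrM -scalerA.
  under eq_bigr do rewrite -scaler_sumr.
  rewrite sum_deltaZ.
  by under eq_bigr do rewrite eq_sym; rewrite sum_deltaZ.
transitivity (\sum_i \sum_j (i == x')%:R *: ((j == y)%:R *:
                (beta d b x i *m alpha c a j y'))).
  rewrite pair_bigA /=; apply: eq_bigr => -[i j] _ /=.
  rewrite alphaE betaE -scalemxAl -scalemxAr !scalerA mulrC.
  by rewrite [y == j]eq_sym.
under eq_bigr do rewrite -scaler_sumr.
by rewrite sum_deltaZ sum_deltaZ.
Qed.

Let alpha_mul c a c' a' y y' :
  \sum_z alpha c a y z *m alpha c' a' z y' = (a == c')%:R *: alpha c a' y y'.
Proof.
transitivity (\sum_s (\sum_b G (c, b) (a, b) (x0, y) s)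
                     *m (\sum_b G (c', b) (a', b) s (x0, y'))).
  transitivity (\sum_i \sum_j (i == x0)%:R *: (alpha c a y j *m alpha c' a' j y')).
    by under [RHS]eq_bigr do rewrite -scaler_sumr; rewrite sum_deltaZ.
  rewrite pair_bigA /=; apply: eq_bigr => -[i j] _ /=.
  rewrite !alphaE -scalemxAl -scalemxAr scalerA [x0 == i]eq_sym.
  by case: (i == x0); rewrite ?mul1r ?mul0r.
under eq_bigr do rewrite mulmx_suml.
rewrite exchange_big /=.
under eq_bigr => b _ do under eq_bigr do rewrite mulmx_sumr.
under eq_bigr => b _ do rewrite exchange_big /=.
rewrite scaler_sumr; apply: eq_bigr => b _.
under eq_bigr do rewrite gram_mul // xpair_eqE andbC -mulnb natrM -scalerA eq_sym.
by rewrite sum_deltaZ.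
Qed.

Let alpha_adj c a y y' : (alpha c a y y') ^t* = alpha a c y' y.
Proof. by rewrite /alpha adjmx_sum; apply: eq_bigr => b _; rewrite gram_adj. Qed.

Let beta_adj c a y y' : (beta c a y y') ^t* = beta a c y' y.
Proof. by rewrite /beta adjmx_sum; apply: eq_bigr => b _; rewrite gram_adj. Qed.

Let sum_alpha y y' : \sum_a alpha a a y y' = (y == y')%:R%:M.
Proof.
rewrite /alpha pair_bigA /=.
transitivity (\sum_e G e e (x0, y) (x0, y')); first by apply: eq_bigr => -[].
by rewrite iso xpair_eqE eqxx.
Qed.

Let sum_beta x x' : \sum_b beta b b x x' = (x == x')%:R%:M.
Proof.
rewrite /beta exchange_big pair_bigA /=.
transitivity (\sum_e G e e (x, y0) (x', y0)); first by apply: eq_bigr => -[].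
by rewrite iso xpair_eqE eqxx andbT.
Qed.

(** These are the N_A and N_B of the overview, with the block at [y0] or [x0] subtracted in place of
    a normalized trace. They vanish exactly when the image is also the identity on the other
    output. *)
Let nA c a y y' := alpha c a y y' - (y == y')%:R *: alpha c a y0 y0.
Let nB d b x x' := beta d b x x' - (x == x')%:R *: beta d b x0 x0.

Let nA_adj c a y y' : (nA c a y y') ^t* = nA a c y' y.
Proof. by rewrite /nA adjmxB adjmx_natZ !alpha_adj eq_sym. Qed.

Let alpha_betaC c a d b x x' y y' :
  alpha c a y y' *m beta d b x x' = beta d b x x' *m alpha c a y y'.
Proof. by rewrite -gram_alpha_beta gram_beta_alpha. Qed.

Let beta_nA c a d b x x' y y' :
  beta d b x x' *m nA c a y y' = nA c a y y' *m beta d b x x'.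
Proof. by rewrite /nA mulmxBl mulmxBr -scalemxAl -scalemxAr !alpha_betaC. Qed.

(** Expanding the product into four Gram blocks turns it into the difference of the two sides of
    [no_AB_term]. *)
Let nB_nA c a d b x x' y y' : nB d b x x' *m nA c a y y' = 0.
Proof.
rewrite /nB mulmxBl -scalemxAl /nA !mulmxBr -!scalemxAr -!gram_beta_alpha.
by apply/eqP; rewrite no_AB_term subrr.
Qed.

Lemma causal_decomposition (e0 : AI * BI) :
  exists p q f g (V1 : 'M[C]_(n, p)) (V2 : 'M[C]_(n, q))
         (W1 : 'M[C]_(m, f)) (W2 : 'M[C]_(m, g)),
  [/\ decomp_mx V1 V2, decomp_mx W1 W2,
      forall e t, u e t *m (V1 *m V1 ^t*) = W1 *m W1 ^t* *m u e t,
      comb_blocks (fun e t => W1 ^t* *m u e t *m V1)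
    & comb_blocks (swap_blocks (fun e t => W2 ^t* *m u e t *m V2))].
Proof.
(* [V2] spans the space R generated by the ranges of all [nA], and [V1] its complement; R will carry
   the combs of B before A. *)
have [p [q [V1 [V2 [dV V1nA kerV2]]]]] :=
  family_range_decomp (fun k : AI * AI * BO * BO => nA k.1.1.1 k.1.1.2 k.1.2 k.2).
have {}V1nA c a y y' : V1 ^t* *m nA c a y y' = 0 by apply: (V1nA (c, a, y, y')).
have nAV1 c a y y' : nA c a y y' *m V1 = 0.
  by rewrite -[nA _ _ _ _]trmxCK nA_adj -[V1]trmxCK -adjmxM V1nA adjmx0.
have nBV2 d b x x' : nB d b x x' *m V2 = 0 by apply: kerV2 => k; rewrite nB_nA.
have V1alpha c a y y' :
    V1 ^t* *m alpha c a y y' = (y == y')%:R *: (V1 ^t* *m alpha c a y0 y0).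
  by apply/eqP; rewrite -subr_eq0 scalemxAr -mulmxBr V1nA.
have alphaV1 c a y y' :
    alpha c a y y' *m V1 = (y == y')%:R *: (alpha c a y0 y0 *m V1).
  by apply/eqP; rewrite -subr_eq0 scalemxAl -mulmxBl nAV1.
have betaV2 d b x x' :
    beta d b x x' *m V2 = (x == x')%:R *: (beta d b x0 x0 *m V2).
  by apply/eqP; rewrite -subr_eq0 scalemxAl -mulmxBl nBV2.
(* Next to [V1], [alpha] is diagonal on B_O, so the sum in [alpha_mul] collapses to one term and the
   blocks at [y0] multiply like matrix units. *)
have V1alpha2 c a c' a' z z' : V1 ^t* *m alpha c a y0 y0 *m alpha c' a' z z'
    = (a == c')%:R *: (V1 ^t* *m alpha c a' z z').
  rewrite scalemxAr -alpha_mul [RHS]mulmx_sumr.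
  rewrite [RHS](eq_bigr (fun w => (w == z)%:R *:
    (V1 ^t* *m alpha c a y0 y0 *m alpha c' a' w z'))) ?sum_deltaZ // => w _.
  by rewrite [LHS]mulmxA (V1alpha _ _ z w) [w == z]eq_sym -scalemxAl.
(* Invariance of R under [alpha], tested on the generators: by [V1alpha2], the product of [alpha]
   with an [nA] is, next to [V1], a multiple of another [nA], which [V1] kills. *)
have alpha12 c a y y' : V1 ^t* *m alpha c a y y' *m V2 = 0.
  apply: kerV2 => -[[[c' a'] z] z'] /=; rewrite V1alpha -scalemxAl /nA mulmxBr -scalemxAr.
  by rewrite !V1alpha2 [V1 ^t* *m alpha _ _ z z']V1alpha !scalerA mulrC subrr scaler0.
(* Here invariance holds because [beta] commutes with every [nA]. *)
have beta12 d b x x' : V1 ^t* *m beta d b x x' *m V2 = 0.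
  by apply: kerV2 => k; rewrite -mulmxA beta_nA mulmxA V1nA mul0mx.
have alpha21 c a y y' : V2 ^t* *m alpha c a y y' *m V1 = 0.
  by rewrite -[RHS]adjmx0 -(alpha12 a c y' y) !adjmxM trmxCK alpha_adj mulmxA.
have beta21 d b x x' : V2 ^t* *m beta d b x x' *m V1 = 0.
  by rewrite -[RHS]adjmx0 -(beta12 b d x' x) !adjmxM trmxCK beta_adj mulmxA.
pose Q := V2 *m V2 ^t*.
have [V11 V22 _ V1Q] := dV.
have QG e e' t t' : Q *m G e e' t t' = G e e' t t' *m Q.
  case: e e' t t' => c d [a b] [x y] [x' y'].
  rewrite gram_alpha_beta mulmxA (decomp_mx_commute dV) // -mulmxA.
  by rewrite (decomp_mx_commute dV) // !mulmxA.
have QQ : Q *m Q = Q by rewrite /Q mulmxA -[_ *m _ *m V2]mulmxA V22 mulmx1.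
have aQ : Q ^t* = Q by rewrite /Q adjmxM trmxCK.
have [QF [QFQF aQF QFu]] := gram_commutant e0 co QG QQ aQ.
have [f [g [W1 [W2 [dW W2E]]]]] := projection_decomp QFQF aQF.
have [_ _ _ W12] := dW.
have u2 e t : u e t *m (V2 *m V2 ^t*) = W2 *m W2 ^t* *m u e t.
  by rewrite W2E QFu.
have u1 e t : u e t *m (V1 *m V1 ^t*) = W1 *m W1 ^t* *m u e t.
  have -> : V1 *m V1 ^t* = 1%:M - V2 *m V2 ^t* by rewrite -V1Q addrK.
  have -> : W1 *m W1 ^t* = 1%:M - W2 *m W2 ^t* by rewrite -W12 addrK.
  by rewrite mulmxBr mulmxBl mulmx1 mul1mx u2.
exists p, q, f, g, V1, V2, W1, W2; split=> //.
(* The Gram block is [beta] times [alpha], and next to [V1] the factor [alpha] reduces to its block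
   at [y0] times the identity on B_O. Summing over B_I then turns [beta] into the identity, which
   leaves R1. *)
- exists (fun c a d b x x' => V1 ^t* *m beta d b x x' *m (alpha c a y0 y0 *m V1)).
  exists (fun c a => V1 ^t* *m (alpha c a y0 y0 *m V1)); split.
  + move=> c a d b x x' y y'; rewrite compression_gram // gram_beta_alpha.
    by rewrite -!mulmxA alphaV1 -!scalemxAr.
  + move=> c a x x'; rewrite -mulmx_suml -mulmx_sumr sum_beta.
    by rewrite mul_mx_scalar -scalemxAl.
  + by rewrite -mulmx_sumr -mulmx_suml sum_alpha eqxx mul1mx.
(* The mirror image, with the factors in the other order so that [beta] stands next to [V2]. *)
- exists (fun d b c a y y' => V2 ^t* *m alpha c a y y' *m (beta d b x0 x0 *m V2)).
  exists (fun d b => V2 ^t* *m (beta d b x0 x0 *m V2)); split.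
  + move=> d b c a y y' x x'.
    rewrite -[LHS]/(gram (fun e t => W2 ^t* *m u e t *m V2) (c, d) (a, b) (x, y) (x', y')).
    by rewrite compression_gram // gram_alpha_beta -!mulmxA betaV2 -!scalemxAr.
  + move=> d b y y'; rewrite -mulmx_suml -mulmx_sumr sum_alpha.
    by rewrite mul_mx_scalar -scalemxAl.
  + by rewrite -mulmx_sumr -mulmx_suml sum_beta eqxx mul1mx.
Qed.

End Causal.

(** * Test channels *)

Section Channels.
Variable C : numClosedFieldType.

Lemma sum_delta (T : finType) (t : T) (F : T -> C) : \sum_s (s == t)%:R * F s = F t.
Proof.
rewrite (bigD1 t) //= eqxx mul1r big1 ?addr0 // => s /negPf ->.
by rewrite mul0r.
Qed.

Lemma sum_option (T : finType) (F : option T -> C) :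
  \sum_l F l = F None + \sum_t F (Some t).
Proof.
rewrite (bigD1 None) //=; congr (_ + _).
rewrite (reindex_omap Some id) /=; last by case.
by apply: eq_bigl => t; rewrite eqxx.
Qed.

Lemma sum_unit (F : unit -> C) : \sum_t F t = F tt.
Proof. by rewrite (big_pred1 tt) // => -[]. Qed.

Definition unit_vec (T : finType) (v : T -> C) := \sum_t (v t)^* * v t = 1.

Lemma unit_vec_delta (T : finType) (t : T) : unit_vec (fun s => (s == t)%:R).
Proof. by rewrite /unit_vec; under eq_bigr do rewrite conjC_nat; rewrite sum_delta eqxx. Qed.

(** Polarization: basis vectors give the diagonal, and the unit vectors (e_t + w e_t') / sqrt 2 with
    w = 1 and w = i give two equations that force the off-diagonal entries to vanish. *)
Lemma constant_form_scalar (T : finType) (B : op C T T) (k : C) :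
  (forall v, unit_vec v -> \sum_s \sum_s' (v s)^* * B s s' * v s' = k) ->
  forall t t', B t t' = (t == t')%:R * k.
Proof.
move=> Bk.
have diag t : B t t = k.
  rewrite -(Bk _ (unit_vec_delta t)).
  transitivity (\sum_s (s == t)%:R * \sum_s' (s' == t)%:R * B s s').
    by rewrite !sum_delta.
  apply: eq_bigr => s _; rewrite mulr_sumr; apply: eq_bigr => s' _.
  by rewrite conjC_nat; ring.
move=> t t'; have [<-|tt'] := eqVneq; first by rewrite mul1r diag.
rewrite mul0r; pose r : C := sqrtC 2^-1.
have rr : r * r = 2^-1 by rewrite -expr2 sqrtCK.
have rK : r^* = r by rewrite geC0_conj // sqrtC_ge0 invr_ge0 ler0n.
have off w : w * w^* = 1 -> w * B t t' + w^* * B t' t = 0.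
  move=> ww; pose v s : C := r * (s == t)%:R + r * w * (s == t')%:R.
  have sum_v (F : T -> C) : \sum_s v s * F s = r * F t + r * w * F t'.
    rewrite /v; under eq_bigr do rewrite mulrDl -!mulrA.
    by rewrite big_split /= -!mulr_sumr !sum_delta mulrA.
  have sum_vC (F : T -> C) : \sum_s (v s)^* * F s = r * F t + r * w^* * F t'.
    rewrite /v; under eq_bigr do
      rewrite rmorphD !rmorphM /= rK !conjC_nat mulrDl -!mulrA.
    by rewrite big_split /= -!mulr_sumr !sum_delta mulrA.
  have uv : unit_vec v.
    rewrite /unit_vec sum_vC /v !eqxx (negPf tt') eq_sym (negPf tt').
    have -> : r * (r * 1 + r * w * 0) + r * w^* * (r * 0 + r * w * 1)
              = r * r * (1 + w * w^*) :> C by ring.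
    by rewrite rr ww -[1 + 1]/(2%:R) mulVf // pnatr_eq0.
  have := Bk v uv.
  have -> : \sum_s \sum_s' (v s)^* * B s s' * v s'
            = \sum_s (v s)^* * \sum_s' v s' * B s s'.
    apply: eq_bigr => s _; rewrite mulr_sumr; apply: eq_bigr => s' _; ring.
  rewrite sum_vC !sum_v !diag => e.
  have {}e : r * r * (k + w * w^* * k + (w * B t t' + w^* * B t' t)) = k.
    by rewrite -[RHS]e; ring.
  move: e; rewrite rr ww mul1r => e.
  have : 2 * (2^-1 * (k + k + (w * B t t' + w^* * B t' t))) = 2 * k by rewrite e.
  rewrite mulVKf ?pnatr_eq0 // => /eqP; rewrite -subr_eq0 => /eqP <-.
  by ring.
have e1 := off 1; rewrite rmorph1 !mul1r in e1; have {}e1 := e1 erefl.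
have ei : 'i * B t t' + 'i^* * B t' t = 0.
  by apply: off; rewrite conjCi mulrN -expr2 sqrCi opprK.
move: ei; rewrite conjCi mulNr -mulrN -mulrDr => /eqP.
rewrite mulf_eq0 (negPf (neq0Ci _)) /= subr_eq0 => /eqP ei.
move/eqP: e1; rewrite -ei -mulr2n mulrn_eq0 /= => /eqP //.
Qed.

(** * Kraus families and the channels they define *)

Definition kraus (I O K : finType) (A : K -> op C O I) :=
  forall i j, \sum_k \sum_o (A k o i)^* * A k o j = (i == j)%:R.

Definition kraus_map (I O K : finType) (A : K -> op C O I) : qmap C I O :=
  fun X o o' => \sum_k \sum_i \sum_j A k o i * X i j * (A k o' j)^*.

Definition kraus_choi (I O K : finType) (A : K -> op C O I) : op C (I * O) (I * O) :=
  fun x y => \sum_k A k x.2 x.1 * (A k y.2 y.1)^*.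

Lemma choi_kraus_map (I O K : finType) (A : K -> op C O I) :
  op_eq (choi (kraus_map A)) (kraus_choi A).
Proof.
move=> [i o] [j o']; rewrite /choi /kraus_map /kraus_choi /=; apply: eq_bigr => k _.
transitivity (\sum_i' (i' == i)%:R * \sum_j' (j' == j)%:R * (A k o i' * (A k o' j')^*)).
  apply: eq_bigr => i' _; rewrite mulr_sumr; apply: eq_bigr => j' _.
  by rewrite -mulnb natrM; ring.
by rewrite !sum_delta.
Qed.

Lemma kraus_map_CP (I O K : finType) (A : K -> op C O I) : CP (kraus_map A).
Proof.
move=> L X Xpsd v.
pose w k (s : L * I) := \sum_o (A k o s.2)^* * v (s.1, o).
suff -> : \sum_t \sum_t' (v t)^* * ampl (kraus_map A) X t t' * v t'
    = \sum_k \sum_s \sum_s' (w k s)^* * X s s' * w k s'.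
  by apply: sumr_ge0 => k _; apply: Xpsd.
transitivity (\sum_k \sum_t \sum_t' \sum_i \sum_j
    (A k t.2 i * (v t)^*) * X (t.1, i) (t'.1, j) * ((A k t'.2 j)^* * v t')).
  rewrite [RHS]exchange_big; apply: eq_bigr => t _ /=.
  rewrite [RHS]exchange_big; apply: eq_bigr => t' _ /=.
  rewrite /ampl /kraus_map mulr_sumr mulr_suml; apply: eq_bigr => k _.
  rewrite mulr_sumr mulr_suml; apply: eq_bigr => i _.
  rewrite mulr_sumr mulr_suml; apply: eq_bigr => j _; ring.
apply: eq_bigr => k _.
transitivity (\sum_l \sum_o \sum_l' \sum_o' \sum_i \sum_j
    (A k o i * (v (l, o))^*) * X (l, i) (l', j) * ((A k o' j)^* * v (l', o'))).
  rewrite [RHS]pair_bigA; apply: eq_bigr => -[l o] _ /=.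
  by rewrite [RHS]pair_bigA; apply: eq_bigr => -[l' o'] _.
transitivity (\sum_l \sum_i \sum_l' \sum_j (w k (l, i))^* * X (l, i) (l', j) * w k (l', j)).
  apply: eq_bigr => l _; rewrite exchange_big [RHS]exchange_big; apply: eq_bigr => l' _ /=.
  under eq_bigr do rewrite exchange_big /=.
  rewrite exchange_big; apply: eq_bigr => i _ /=.
  under eq_bigr do rewrite exchange_big /=.
  rewrite exchange_big; apply: eq_bigr => j _ /=.
  rewrite /w /= rmorph_sum !mulr_suml; apply: eq_bigr => o _.
  rewrite mulr_sumr; apply: eq_bigr => o' _.
  by rewrite rmorphM /= conjCK.
rewrite pair_bigA; apply: eq_bigr => -[l i] _ /=.
by rewrite pair_bigA; apply: eq_bigr => -[l' j] _.
Qed.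

Lemma kraus_map_CPTP (I O K : finType) (A : K -> op C O I) :
  kraus A -> CPTP (kraus_map A).
Proof.
move=> krA; split; last 1 first.
- move=> X; rewrite /trace /kraus_map.
  transitivity (\sum_i \sum_j X i j * \sum_k \sum_o (A k o j)^* * A k o i).
    rewrite exchange_big /=; under eq_bigr do rewrite exchange_big /=.
    rewrite exchange_big; apply: eq_bigr => i _ /=.
    under eq_bigr do rewrite exchange_big /=.
    rewrite exchange_big; apply: eq_bigr => j _ /=.
    rewrite mulr_sumr; apply: eq_bigr => k _.
    by rewrite mulr_sumr; apply: eq_bigr => o _; ring.
  apply: eq_bigr => i _; under eq_bigr do rewrite krA mulrC.
  by rewrite sum_delta.
- move=> a X Y o o'; rewrite /kraus_map mulr_sumr -big_split; apply: eq_bigr => k _ /=.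
  rewrite mulr_sumr -big_split; apply: eq_bigr => i _ /=.
  by rewrite mulr_sumr -big_split; apply: eq_bigr => j _ /=; ring.
- exact: kraus_map_CP.
Qed.

(** The channel that discards its input and prepares [s]. The guard [I ->] drops the normalization
    for an empty input space. *)
Lemma kraus_replace (I O : finType) (s : O -> C) : (I -> unit_vec s) ->
  kraus (fun (l : I) (o : O) (i : I) => s o * (i == l)%:R).
Proof.
move=> us i j.
transitivity (\sum_l (l == i)%:R * ((j == l)%:R * \sum_o (s o)^* * s o)).
  apply: eq_bigr => l _; rewrite !mulr_sumr; apply: eq_bigr => o _.
  by rewrite rmorphM /= conjC_nat [i == l]eq_sym; ring.
by rewrite sum_delta us // mulr1 eq_sym.
Qed.

(** * Linear functionals that are constant on channels *)

Definition pairing (X : finType) (c e : op C X X) := \sum_x \sum_y c x y * e x y.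

(** Measure-and-prepare channels suffice: changing the state prepared after one outcome must not
    change the value, so by polarization in the prepared state and then in the measured vector, [c]
    is the identity on the output. *)
Lemma channel_functional_constant (I O : finType) (c : op C (I * O) (I * O)) (k : C) :
  (forall (K : finType) (A : K -> op C O I), kraus A -> pairing c (kraus_choi A) = k) ->
  forall o0 i j o o', c (i, o) (j, o') = (o == o')%:R * c (i, o0) (j, o0).
Proof.
move=> ck o0.
pose h (v : I -> C) (u : O -> C) :=
  \sum_x \sum_y c x y * ((u x.2 * (u y.2)^*) * ((v x.1)^* * v y.1)).
have h_const v u1 u0 : unit_vec v -> unit_vec u1 -> unit_vec u0 -> h v u1 = h v u0.
  move=> uv.
  (* [h] is the contribution of the outcome |v><v|, and [rest] that of its complement. *)
  pose rest (u : O -> C) := \sum_x \sum_y c x y * ((u x.2 * (u y.2)^*)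
        * ((y.1 == x.1)%:R - (v x.1)^* * v y.1)).
  have test u u' : unit_vec u -> unit_vec u' -> h v u + rest u' = k.
    move=> uu uu'.
    (* measure |v><v|; prepare u on success and u' on failure *)
    pose A (l : option I) : op C O I := fun o i =>
      if l is Some l' then u' o * ((i == l')%:R - v l' * (v i)^*) else u o * (v i)^*.
    have proj i j : \sum_l ((i == l)%:R - v l * (v i)^*)^* * ((j == l)%:R - v l * (v j)^*)
        = (j == i)%:R - v i * (v j)^*.
      transitivity (\sum_l ((l == i)%:R * ((j == l)%:R - v l * (v j)^*)
          - v i * ((l == j)%:R * (v l)^*) + v i * (v j)^* * ((v l)^* * v l))).
        apply: eq_bigr => l _.
        rewrite rmorphB rmorphM /= conjC_nat conjCK [i == l]eq_sym [j == l]eq_sym; ring.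
      rewrite big_split sumrB /= -!mulr_sumr !sum_delta uv; ring.
    have krA : kraus A.
      move=> i j; rewrite sum_option /A.
      transitivity (v i * (v j)^* * (\sum_o (u o)^* * u o)
        + (\sum_l ((i == l)%:R - v l * (v i)^*)^* * ((j == l)%:R - v l * (v j)^*))
          * (\sum_o (u' o)^* * u' o)).
        congr (_ + _).
          rewrite mulr_sumr; apply: eq_bigr => o _; rewrite rmorphM /= conjCK; ring.
        rewrite mulr_suml; apply: eq_bigr => l _.
        by rewrite mulr_sumr; apply: eq_bigr => o _; rewrite rmorphM /=; ring.
      by rewrite uu uu' proj eq_sym; ring.
    rewrite -(ck _ A krA) /h /rest /pairing -big_split; apply: eq_bigr => -[i o] _.
    rewrite -big_split; apply: eq_bigr => -[j o'] _ /=.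
    rewrite -mulrDr; congr (_ * _); rewrite /kraus_choi sum_option /A /=.
    rewrite rmorphM /= conjCK; congr (_ + _); first by ring.
    transitivity ((\sum_l ((j == l)%:R - v l * (v j)^*)^* * ((i == l)%:R - v l * (v i)^*))
       * (u' o * (u' o')^*)).
      by rewrite proj eq_sym; ring.
    by rewrite mulr_suml; apply: eq_bigr => l _; rewrite rmorphM /=; ring.
  (* Both tests prepare [u0] on failure, so the failure terms cancel. *)
  move=> uu1 uu0; apply: (addIr (rest u0)).
  by rewrite !test.
(* The output indices are transposed so that [h v u] becomes the quadratic form of [B v] at [u]. *)
pose B v o' o := \sum_i \sum_j c (i, o) (j, o') * ((v i)^* * v j).
have hB v u : \sum_o' \sum_o (u o')^* * B v o' o * u o = h v u.
  transitivity (\sum_o \sum_i \sum_o' \sum_j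
     c (i, o) (j, o') * ((u o * (u o')^*) * ((v i)^* * v j))).
    rewrite exchange_big; apply: eq_bigr => o _ /=.
    rewrite [RHS]exchange_big; apply: eq_bigr => o' _ /=.
    rewrite /B mulr_sumr mulr_suml; apply: eq_bigr => i _.
    by rewrite mulr_sumr mulr_suml; apply: eq_bigr => j _; ring.
  rewrite exchange_big pair_bigA; apply: eq_bigr => -[i o] _ /=.
  by rewrite exchange_big pair_bigA; apply: eq_bigr => -[j o'] _.
have BE v o' o : unit_vec v -> B v o' o = (o' == o)%:R * B v o0 o0.
  move=> uv; have ud := @unit_vec_delta O.
  have := constant_form_scalar (B := B v) (k := h v (fun s => (s == o0)%:R)).
  move=> key; have {}key := key (fun u uu => etrans (hB v u) (h_const _ _ _ uv uu (ud o0))).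
  by rewrite key [B v o0 o0]key eqxx mul1r.
move=> i j o o'.
(* For fixed outputs the discrepancy is a quadratic form in [v] that vanishes on unit vectors, so
   polarization applies once more. *)
pose D : op C I I := fun i j => c (i, o) (j, o') - (o' == o)%:R * c (i, o0) (j, o0).
have D0 : D i j = (i == j)%:R * 0.
  apply: constant_form_scalar => v uv.
  transitivity (B v o' o - (o' == o)%:R * B v o0 o0); last by rewrite BE // subrr.
  rewrite /B mulr_sumr -sumrB; apply: eq_bigr => i' _.
  by rewrite mulr_sumr -sumrB; apply: eq_bigr => j' _; rewrite /D; ring.
by move/eqP: D0; rewrite mulr0 subr_eq0 => /eqP ->; rewrite eq_sym.
Qed.

End Channels.

(** * Causality conditions of a superchannel *)

Section Superchannels.
Variable C : numClosedFieldType.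

Lemma sum_pair_unit (T : finType) (F : T * unit -> C) : \sum_x F x = \sum_t F (t, tt).
Proof.
transitivity (\sum_t \sum_s F (t, s)); last by apply: eq_bigr => t _; rewrite sum_unit.
by rewrite pair_bigA; apply: eq_bigr => -[].
Qed.

Lemma kraus_unit (I O K : finType) (A : K -> op C O I) : kraus A ->
  kraus (fun k (o : O * unit) (i : I * unit) => A k o.1 i.1).
Proof.
move=> krA [i []] [j []]; rewrite xpair_eqE eqxx andbT -krA.
by apply: eq_bigr => k _; rewrite sum_pair_unit.
Qed.

Lemma pairing_exchange (X Y : finType) (c : X -> X -> Y -> Y -> C) (a : op C X X)
    (b : op C Y Y) :
  pairing (fun x x' => pairing (c x x') b) a
  = pairing (fun y y' => pairing (fun x x' => c x x' y y') a) b.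
Proof.
transitivity (\sum_x \sum_x' \sum_y \sum_y' c x x' y y' * (b y y' * a x x')).
  apply: eq_bigr => x _; apply: eq_bigr => x' _; rewrite /pairing mulr_suml.
  apply: eq_bigr => y _; rewrite mulr_suml; apply: eq_bigr => y' _; ring.
under eq_bigr do rewrite exchange_big /=.
rewrite exchange_big; apply: eq_bigr => y _ /=.
under eq_bigr do rewrite exchange_big /=.
rewrite exchange_big; apply: eq_bigr => y' _ /=.
rewrite /pairing mulr_suml; apply: eq_bigr => x _; rewrite mulr_suml.
by apply: eq_bigr => x' _; ring.
Qed.

Definition trF (P AI AO BI BO F : finType) (W : op6 C P AI AO BI BO F) p q
    (xa ya : AI * AO) (xb yb : BI * BO) : C :=
  \sum_f W (p, xa.1, xa.2, xb.1, xb.2, f) (q, ya.1, ya.2, yb.1, yb.2, f).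

(** With one-dimensional auxiliary spaces, the left side is the trace of the image of |p><q| under
    the output channel, which preserves traces. *)
Lemma superchannel_kraus (P AI AO BI BO F KA KB : finType) (W : op6 C P AI AO BI BO F)
    (A : KA -> op C AO AI) (B : KB -> op C BO BI) p q :
  superchannel W -> kraus A -> kraus B ->
  pairing (fun xa ya => pairing (trF W p q xa ya) (kraus_choi B)) (kraus_choi A)
  = (p == q)%:R.
Proof.
move=> sW krA krB.
have [M [[_ _ tpM] choiM]] :=
  sW _ _ _ _ _ _ (kraus_map_CPTP (kraus_unit krA)) (kraus_map_CPTP (kraus_unit krB)).
pose X : op C (P * unit * unit) (P * unit * unit) :=
  fun i i' => ((i == (p, tt, tt)) && (i' == (q, tt, tt)))%:R.
have <- : trace X = (p == q)%:R.
  rewrite /trace /X !sum_pair_unit -(sum_delta p (fun s => (s == q)%:R)).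
  by apply: eq_bigr => s _; rewrite !xpair_eqE !eqxx !andbT -mulnb natrM.
rewrite -tpM /trace !sum_pair_unit.
transitivity (\sum_f \sum_xa \sum_xb \sum_ya \sum_yb
   W (p, xa.1, xa.2, xb.1, xb.2, f) (q, ya.1, ya.2, yb.1, yb.2, f)
   * (kraus_choi A xa ya * kraus_choi B xb yb)).
  rewrite /pairing [RHS]exchange_big; apply: eq_bigr => xa _ /=.
  under [RHS]eq_bigr do rewrite exchange_big /=.
  rewrite [RHS]exchange_big; apply: eq_bigr => ya _ /=.
  rewrite mulr_suml [RHS]exchange_big; apply: eq_bigr => xb _ /=.
  rewrite mulr_suml [RHS]exchange_big; apply: eq_bigr => yb _ /=.
  by rewrite /trF -mulrA mulr_suml; apply: eq_bigr => f _; rewrite [X in _ * X]mulrC.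
apply: eq_bigr => f _; rewrite -/(choi M ((p, tt, tt), (f, tt, tt)) ((q, tt, tt), (f, tt, tt))).
rewrite choiM /sc_apply /link /= pair_bigA; apply: eq_bigr => -[[ai ao] [bi bo]] _ /=.
rewrite pair_bigA; apply: eq_bigr => -[[ci co] [di do_]] _ /=.
by rewrite !choi_kraus_map.
Qed.

Section Blocks.
Variables (P AI AO BI BO F : finType) (U : op C (AI * BI * F) (P * AO * BO)).

Definition blocks (e : AI * BI) (t : AO * BO) : 'M[C]_(#|F|, #|P|) :=
  \matrix_(f, p) U (e, enum_val f) (enum_val p, t.1, t.2).

(** The indices come out transposed because a Gram block conjugates its first factor and the Choi
    operator its second. *)
Lemma gram_blocks a b c d x y x' y' p q :
  gram blocks (c, d) (a, b) (x, y) (x', y') (enum_rank q) (enum_rank p)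
  = trF (choi_vec_op U) p q (a, x') (c, x) (b, y') (d, y).
Proof.
rewrite /gram /trF mxE (reindex (@enum_rank F)) /=;
    last exact: onW_bij (@enum_rank_bij F).
by apply: eq_bigr => f _; rewrite !mxE !enum_rankK mulrC.
Qed.

Lemma unitary_block_isometry : unitary U -> block_isometry blocks.
Proof.
move=> [iso _] [x y] [x' y']; apply/matrixP => i j.
have := iso (enum_val i, x, y) (enum_val j, x', y'); rewrite /mulop /adj /idop.
rewrite summxE !xpair_eqE (inj_eq enum_val_inj) !mxE -mulrnA mulnb -andbA andbC => <-.
transitivity (\sum_e \sum_f (U (e, f) (enum_val i, x, y))^* * U (e, f) (enum_val j, x', y')).
  apply: eq_bigr => e _; rewrite mxE (reindex (@enum_rank F)) /=;
    last exact: onW_bij (@enum_rank_bij F).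
  by apply: eq_bigr => f _; rewrite !mxE enum_rankK.
by rewrite pair_bigA; apply: eq_bigr => -[].
Qed.

Lemma unitary_block_coisometry : unitary U -> block_coisometry blocks.
Proof.
move=> [_ co] e e'; apply/matrixP => i j.
have := co (e, enum_val i) (e', enum_val j); rewrite /mulop /adj /idop.
rewrite summxE xpair_eqE (inj_eq enum_val_inj) !mxE -mulrnA mulnb => <-.
transitivity (\sum_t \sum_p U (e, enum_val i) (p, t.1, t.2) * (U (e', enum_val j) (p, t.1, t.2))^*).
  apply: eq_bigr => t _; rewrite mxE (reindex (@enum_rank P)) /=;
    last exact: onW_bij (@enum_rank_bij P).
  by apply: eq_bigr => p _; rewrite !mxE enum_rankK.
rewrite exchange_big pair_bigA.
rewrite (reindex (fun s : P * AO * BO => (s.1.1, (s.1.2, s.2)))) /=.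
  by apply: eq_bigr => -[[]].
by exists (fun s => (s.1, s.2.1, s.2.2)) => [[[]]|[? []]].
Qed.

End Blocks.
End Superchannels.

(** * Testing the two slots one after the other *)

Section CausalConditions.
Variable C : numClosedFieldType.

Lemma pairing_replace (I O : finType) (c : op C (I * O) (I * O)) (o : O) :
  pairing c (kraus_choi (fun (l : I) o' i => (o' == o)%:R * (i == l)%:R))
  = \sum_i c (i, o) (i, o).
Proof.
have choiE i j s s' : kraus_choi (fun (l : I) o' i => (o' == o)%:R * (i == l)%:R)
    (i, s) (j, s') = (s == o)%:R * ((s' == o)%:R * (j == i)%:R) :> C.
  rewrite /kraus_choi /=.
  transitivity (\sum_l (l == i)%:R * ((s == o)%:R * ((s' == o)%:R * (j == l)%:R)) : C).
    apply: eq_bigr => l _; rewrite rmorphM /= !conjC_nat [i == l]eq_sym; ring.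
  by rewrite sum_delta.
rewrite /pairing.
transitivity (\sum_i \sum_s (s == o)%:R * \sum_j (j == i)%:R * \sum_s' (s' == o)%:R
    * c (i, s) (j, s')).
  rewrite [RHS]pair_bigA; apply: eq_bigr => -[i s] _ /=; rewrite mulr_sumr.
  transitivity (\sum_j \sum_s' c (i, s) (j, s') *
       ((s == o)%:R * ((s' == o)%:R * (j == i)%:R))).
    by rewrite [RHS]pair_bigA; apply: eq_bigr => -[j s'] _ /=; rewrite choiE.
  apply: eq_bigr => j _; rewrite !mulr_sumr; apply: eq_bigr => s' _; ring.
by apply: eq_bigr => i _; rewrite !sum_delta.
Qed.

Lemma pairingB (X : finType) (c c' e : op C X X) (k : C) :
  pairing (fun x y => c x y - k * c' x y) e = pairing c e - k * pairing c' e.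
Proof.
rewrite /pairing mulr_sumr -sumrB; apply: eq_bigr => x _.
by rewrite mulr_sumr -sumrB; apply: eq_bigr => y _; rewrite mulrBl mulrA.
Qed.

Variables (P AI AO BI BO F : finType) (W : op6 C P AI AO BI BO F).
Variables (x0 : AO) (y0 : BO) (p q : P).
Hypothesis sW : superchannel W.
Local Notation w := (trF W p q).

(** For a fixed channel in slot A, the value is a functional of the channel in slot B that is
    constant on all channels. *)
Lemma superchannel_B_independent (KA : finType) (A : KA -> op C AO AI) b d y y' :
  kraus A ->
  pairing (fun xa ya => w xa ya (b, y) (d, y')) (kraus_choi A)
  = (y == y')%:R * pairing (fun xa ya => w xa ya (b, y0) (d, y0)) (kraus_choi A).
Proof.
move=> krA.
apply: (@channel_functional_constant C BI BO
  (fun xb yb => pairing (fun xa ya => w xa ya xb yb) (kraus_choi A)) (p == q)%:R) => K B krB.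
by rewrite -(superchannel_kraus p q sW krA krB) [RHS]pairing_exchange.
Qed.

Lemma superchannel_A_independent (KB : finType) (B : KB -> op C BO BI) a c x x' :
  kraus B ->
  pairing (w (a, x) (c, x')) (kraus_choi B)
  = (x == x')%:R * pairing (w (a, x0) (c, x0)) (kraus_choi B).
Proof.
move=> krB.
apply: (@channel_functional_constant C AI AO
  (fun xa ya => pairing (w xa ya) (kraus_choi B)) (p == q)%:R) => K A krA.
exact: (superchannel_kraus p q sW krA krB).
Qed.

(** By [superchannel_B_independent] the left side, as a functional of the channel in slot A, is zero
    on every channel; testing slot A then gives the claim. *)
Lemma superchannel_no_AB_term a c b d x x' y y' :
  w (a, x) (c, x') (b, y) (d, y') - (y == y')%:R * w (a, x) (c, x') (b, y0) (d, y0)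
  = (x == x')%:R * (w (a, x0) (c, x0) (b, y) (d, y')
                    - (y == y')%:R * w (a, x0) (c, x0) (b, y0) (d, y0)).
Proof.
apply: (@channel_functional_constant C AI AO (fun xa ya =>
  w xa ya (b, y) (d, y') - (y == y')%:R * w xa ya (b, y0) (d, y0)) 0) => K A krA.
by rewrite pairingB superchannel_B_independent // subrr.
Qed.

Lemma superchannel_no_B_term b d y y' :
  \sum_a w (a, x0) (a, x0) (b, y) (d, y')
  = (y == y')%:R * \sum_a w (a, x0) (a, x0) (b, y0) (d, y0).
Proof.
have := superchannel_B_independent b d y y' (kraus_replace (fun=> unit_vec_delta C x0)).
by rewrite !pairing_replace.
Qed.

Lemma superchannel_no_A_term a c x x' :
  \sum_b w (a, x) (c, x') (b, y0) (b, y0)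
  = (x == x')%:R * \sum_b w (a, x0) (c, x0) (b, y0) (b, y0).
Proof.
have := superchannel_A_independent a c x x' (kraus_replace (fun=> unit_vec_delta C y0)).
by rewrite !pairing_replace.
Qed.

End CausalConditions.

(** * Reassembling the combs *)

Section Assembly.
Variable C : numClosedFieldType.

Lemma scalemxE m n (k : C) (A : 'M[C]_(m, n)) i j : (k *: A) i j = k * A i j.
Proof. by rewrite mxE. Qed.

Lemma subZmxE m n (k : C) (A B : 'M[C]_(m, n)) i j :
  (A - k *: B) i j = A i j - k * B i j.
Proof. by rewrite !mxE. Qed.

Lemma blocks_causal_decomposition (P AI AO BI BO F : finType)
    (U : op C (AI * BI * F) (P * AO * BO)) (a0 : AI) (b0 : BI) (x0 : AO) (y0 : BO) :
  unitary U -> superchannel (choi_vec_op U) ->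
  exists p q f g (V1 : 'M[C]_(#|P|, p)) (V2 : 'M[C]_(#|P|, q))
         (W1 : 'M[C]_(#|F|, f)) (W2 : 'M[C]_(#|F|, g)),
  [/\ decomp_mx V1 V2, decomp_mx W1 W2,
      forall e t, blocks U e t *m (V1 *m V1 ^t*) = W1 *m W1 ^t* *m blocks U e t,
      comb_blocks (fun e t => W1 ^t* *m blocks U e t *m V1)
    & comb_blocks (swap_blocks (fun e t => W2 ^t* *m blocks U e t *m V2))].
Proof.
move=> uU sW; apply: (@causal_decomposition _ _ _ _ _ _ _ _ x0 y0 _ _ _ _ _ (a0, b0)).
- exact: unitary_block_isometry.
- exact: unitary_block_coisometry.
- move=> c a d b x x' y y'; apply/matrixP => i j.
  rewrite -(enum_valK i) -(enum_valK j) scalemxE !subZmxE !gram_blocks.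
  by rewrite [x == x']eq_sym [y == y']eq_sym; apply: superchannel_no_AB_term.
- move=> d b y y'; apply/matrixP => i j; rewrite -(enum_valK i) -(enum_valK j) scalemxE !summxE.
  under eq_bigr do rewrite gram_blocks.
  under [in RHS]eq_bigr do rewrite gram_blocks.
  by rewrite [y == y']eq_sym; apply: superchannel_no_B_term.
- move=> c a x x'; apply/matrixP => i j; rewrite -(enum_valK i) -(enum_valK j) scalemxE !summxE.
  under eq_bigr do rewrite gram_blocks.
  under [in RHS]eq_bigr do rewrite gram_blocks.
  by rewrite [x == x']eq_sym; apply: superchannel_no_A_term.
Qed.

Definition of_blocks (AI BI AO BO : finType) m n
    (u : AI * BI -> AO * BO -> 'M[C]_(m, n)) : op C (AI * BI * 'I_m) ('I_n * AO * BO) :=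
  fun e s => u e.1 (s.1.2, s.2) e.2 s.1.1.

Lemma of_blocks_unitary (AI BI AO BO : finType) m n
    (u : AI * BI -> AO * BO -> 'M[C]_(m, n)) :
  block_isometry u -> block_coisometry u -> unitary (of_blocks u).
Proof.
move=> iso co; split.
- move=> [[i x] y] [[j x'] y']; rewrite /mulop /adj /idop !xpair_eqE -andbA andbC.
  have /matrixP/(_ i j) := iso (x, y) (x', y').
  rewrite xpair_eqE summxE !mxE -mulrnA mulnb => <-.
  transitivity (\sum_e \sum_f (u e (x, y) f i)^* * u e (x', y') f j).
    by rewrite pair_bigA; apply: eq_bigr => -[].
  by apply: eq_bigr => e _; rewrite mxE; apply: eq_bigr => f _; rewrite !mxE.
- move=> [e i] [e' j]; rewrite /mulop /adj /idop xpair_eqE.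
  have /matrixP/(_ i j) := co e e'.
  rewrite summxE !mxE -mulrnA mulnb => <-.
  transitivity (\sum_t \sum_p u e t i p * (u e' t j p)^*).
    rewrite exchange_big pair_bigA.
    rewrite (reindex (fun s : 'I_n * AO * BO => (s.1.1, (s.1.2, s.2)))) /=.
      by apply: eq_bigr => -[[]].
    by exists (fun s => (s.1, s.2.1, s.2.2)) => [[[]]|[? []]].
  by apply: eq_bigr => t _; rewrite mxE; apply: eq_bigr => p _; rewrite !mxE.
Qed.

Lemma psd_choi_vec_op (P AI AO BI BO F : finType) (U : op C (AI * BI * F) (P * AO * BO)) :
  psd (choi_vec_op U).
Proof.
move=> v.
pose z (x : P * AI * AO * BI * BO * F) :=
  let '(p, ai, ao, bi, bo, f) := x in U (ai, bi, f) (p, ao, bo).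
have -> : \sum_t \sum_t' (v t)^* * choi_vec_op U t t' * v t'
    = (\sum_t (v t)^* * z t) * (\sum_t (v t)^* * z t)^*.
  rewrite rmorph_sum mulr_suml; apply: eq_bigr => t _.
  rewrite mulr_sumr; apply: eq_bigr => t' _; rewrite rmorphM /= conjCK.
  by case: t => -[[[[? ?] ?] ?] ?] ?; case: t' => -[[[[? ?] ?] ?] ?] ? /=; ring.
exact: mul_conjC_ge0.
Qed.

Lemma comb_AB_of_blocks (AI BI AO BO : finType) m n
    (u : AI * BI -> AO * BO -> 'M[C]_(m, n)) :
  comb_blocks u -> comb_AB (choi_vec_op (of_blocks u)).
Proof.
move=> [R2 [R1 [h2 h1 h0]]]; split; first exact: psd_choi_vec_op.
(* Row and column indices are exchanged to undo the transposition between Gram blocks and the Choi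
   operator. *)
exists (fun x y : 'I_n * AI * AO * BI => let '(p, a, ao, b) := x in
  let '(q, c, co, d) := y in R2 c a d b co ao q p).
exists (fun x y : 'I_n * AI => R1 y.2 x.2 y.1 x.1); split.
- move=> p a ao b bo q c co d do_; move/matrixP/(_ q p): (h2 c a d b co ao do_ bo).
  rewrite !mxE eq_sym => <-; apply: eq_bigr => f _.
  by rewrite !mxE mulrC.
- move=> p a ao q c co /=; move/matrixP/(_ q p): (h1 c a co ao).
  by rewrite summxE !mxE eq_sym.
- move=> p q /=; move/matrixP/(_ q p): h0.
  by rewrite summxE !mxE eq_sym.
Qed.

Definition swapAB (P AI AO BI BO F : finType) (U : op C (AI * BI * F) (P * AO * BO)) :
    op C (BI * AI * F) (P * BO * AO) :=
  fun e s => U (e.1.2, e.1.1, e.2) (s.1.1, s.2, s.1.2).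

Lemma comb_BA_swapAB (P AI AO BI BO F : finType) (U : op C (AI * BI * F) (P * AO * BO)) :
  comb_AB (choi_vec_op (swapAB U)) -> comb_BA (choi_vec_op U).
Proof.
move=> [Wpsd [R2 [R1 [h2 h1 h0]]]]; split; last by exists R2, R1; split.
move=> v; apply: (le_trans (Wpsd v)); rewrite le_eqVlt; apply/orP; left; apply/eqP.
apply: eq_bigr => -[[[[[? ?] ?] ?] ?] ?] _.
by apply: eq_bigr => -[[[[[? ?] ?] ?] ?] ?] _.
Qed.

Lemma comb_AB_no_past (P AI AO BI BO F : finType) (U : op C (AI * BI * F) (P * AO * BO)) :
  (P -> False) -> comb_AB (choi_vec_op U).
Proof.
move=> noP; split; first exact: psd_choi_vec_op.
by exists (fun _ _ => 0), (fun _ _ => 0); split=> p; case: (noP p).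
Qed.

Lemma comb_AB_no_output (P AI AO BI BO F : finType) (U : op C (AI * BI * F) (P * AO * BO))
    (a0 : AI) :
  (AO -> False) -> comb_AB (choi_vec_op U).
Proof.
move=> noAO; split; first exact: psd_choi_vec_op.
(* With no A_O only the normalization of R1 remains to be met; placing all the weight at [a0]
   achieves it. *)
exists (fun _ _ => 0), (fun x y => (x.2 == a0)%:R * (x.1 == y.1)%:R); split.
- by move=> p a ao; case: (noAO ao).
- by move=> p a ao; case: (noAO ao).
- by move=> p q /=; rewrite (sum_delta a0 (fun=> (p == q)%:R)).
Qed.

Lemma orth_decomp_mx (T : finType) p q (V1 : 'M[C]_(#|T|, p)) (V2 : 'M[C]_(#|T|, q)) :
  decomp_mx V1 V2 ->
  orth_decomp (fun t j => V1 (enum_rank t) j) (fun t j => V2 (enum_rank t) j).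
Proof.
have adjE r s (A : 'M[C]_(#|T|, r)) (B : 'M[C]_(#|T|, s)) i j :
    mulop (adj (fun t j => A (enum_rank t) j)) (fun t j => B (enum_rank t) j) i j
    = (A ^t* *m B) i j.
  rewrite mxE (reindex (@enum_rank T)) /=; last exact: onW_bij (@enum_rank_bij T).
  by apply: eq_bigr => t _; rewrite !mxE.
have mulE r (A : 'M[C]_(#|T|, r)) t t' :
    mulop (fun t j => A (enum_rank t) j) (adj (fun t j => A (enum_rank t) j)) t t'
    = (A *m A ^t*) (enum_rank t) (enum_rank t').
  by rewrite mxE; apply: eq_bigr => j _; rewrite !mxE.
case=> h1 h2 h3 h4; split.
- by move=> i j; rewrite adjE h1 mxE.
- by move=> i j; rewrite adjE h2 mxE.
- by move=> i j; rewrite adjE h3 mxE.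
- move=> t t'; move/matrixP/(_ (enum_rank t) (enum_rank t')): h4.
  by rewrite !mulE mxE => ->; rewrite mxE (inj_eq enum_rank_inj).
Qed.

Lemma restricts_blocks (P AI AO BI BO F : finType)
    (U : op C (AI * BI * F) (P * AO * BO)) p f
    (V : 'M[C]_(#|P|, p)) (W : 'M[C]_(#|F|, f)) :
  V ^t* *m V = 1%:M ->
  (forall e t, blocks U e t *m (V *m V ^t*) = W *m W ^t* *m blocks U e t) ->
  restricts U (fun t j => V (enum_rank t) j) (fun t j => W (enum_rank t) j)
    (of_blocks (fun e t => W ^t* *m blocks U e t *m V)).
Proof.
move=> VV uVW a b g q x y.
transitivity ((blocks U (a, b) (x, y) *m V) (enum_rank g) q).
  rewrite mxE [RHS](reindex (@enum_rank P)) /=;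
    last exact: onW_bij (@enum_rank_bij P).
  by apply: eq_bigr => s _; rewrite !mxE !enum_rankK.
(* Inserting V^* V = 1 on the right lets the intertwining relation produce W W^* on the left. *)
have -> : blocks U (a, b) (x, y) *m V
    = W *m (W ^t* *m blocks U (a, b) (x, y) *m V).
  by rewrite !mulmxA -uVW -!mulmxA VV mulmx1.
by rewrite mxE.
Qed.

Definition direct_sum_of_combs (P AI AO BI BO F : finType)
    (U : op C (AI * BI * F) (P * AO * BO)) :=
  exists (p1 p2 f1 f2 : nat)
    (V1 : op C P 'I_p1) (V2 : op C P 'I_p2)
    (W1 : op C F 'I_f1) (W2 : op C F 'I_f2)
    (U1 : op C (AI * BI * 'I_f1) ('I_p1 * AO * BO))
    (U2 : op C (AI * BI * 'I_f2) ('I_p2 * AO * BO)),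
    [/\ orth_decomp V1 V2,
        orth_decomp W1 W2,
        unitary U1 /\ comb_AB (choi_vec_op U1),
        unitary U2 /\ comb_BA (choi_vec_op U2)
      & restricts U V1 W1 U1 /\ restricts U V2 W2 U2].

Lemma direct_sum_of_blocks (P AI AO BI BO F : finType)
    (U : op C (AI * BI * F) (P * AO * BO)) p q f g
    (V1 : 'M[C]_(#|P|, p)) (V2 : 'M[C]_(#|P|, q))
    (W1 : 'M[C]_(#|F|, f)) (W2 : 'M[C]_(#|F|, g)) :
  unitary U -> decomp_mx V1 V2 -> decomp_mx W1 W2 ->
  (forall e t, blocks U e t *m (V1 *m V1 ^t*) = W1 *m W1 ^t* *m blocks U e t) ->
  comb_AB (choi_vec_op (of_blocks (fun e t => W1 ^t* *m blocks U e t *m V1))) ->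
  comb_BA (choi_vec_op (of_blocks (fun e t => W2 ^t* *m blocks U e t *m V2))) ->
  direct_sum_of_combs U.
Proof.
move=> uU dV dW u1 c1 c2.
have iso := unitary_block_isometry uU; have co := unitary_block_coisometry uU.
have [V11 V22 _ V12] := dV; have [W11 W22 _ W12] := dW.
have u2 e t : blocks U e t *m (V2 *m V2 ^t*) = W2 *m W2 ^t* *m blocks U e t.
  have -> : V2 *m V2 ^t* = 1%:M - V1 *m V1 ^t* by rewrite -V12 addrC addKr.
  have -> : W2 *m W2 ^t* = 1%:M - W1 *m W1 ^t* by rewrite -W12 addrC addKr.
  by rewrite mulmxBr mulmxBl mulmx1 mul1mx u1.
exists p, q, f, g, (fun t j => V1 (enum_rank t) j), (fun t j => V2 (enum_rank t) j).
exists (fun t j => W1 (enum_rank t) j), (fun t j => W2 (enum_rank t) j).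
exists (of_blocks (fun e t => W1 ^t* *m blocks U e t *m V1)).
exists (of_blocks (fun e t => W2 ^t* *m blocks U e t *m V2)).
split; [exact: orth_decomp_mx | exact: orth_decomp_mx | split=> // | split=> // |].
- by apply: of_blocks_unitary; [exact: compression_isometry | exact: compression_coisometry].
- by apply: of_blocks_unitary; [exact: compression_isometry | exact: compression_coisometry].
- by split; apply: restricts_blocks.
Qed.

(** * Cases with an empty space *)

Lemma ord_card_empty (T : finType) : (T -> False) -> 'I_#|T| -> False.
Proof. by move=> noT i; apply/noT/(enum_val i). Qed.

(** All of P and F goes into the first summand; the second has past ['I_0], where the comb
    conditions hold vacuously. *)
Lemma direct_sum_AB (P AI AO BI BO F : finType) (U : op C (AI * BI * F) (P * AO * BO)) :
  unitary U ->
  (forall m (U1 : op C (AI * BI * 'I_m) ('I_#|P| * AO * BO)), comb_AB (choi_vec_op U1)) ->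
  direct_sum_of_combs U.
Proof.
move=> uU comb; apply: (direct_sum_of_blocks uU (decomp_mx_full C #|P|) (decomp_mx_full C #|F|)).
- by move=> e t; case: (decomp_mx_full C #|P|) (decomp_mx_full C #|F|);
    rewrite !mul0mx !addr0 => _ _ _ -> [_ _ _]; rewrite mul0mx addr0 => ->; rewrite mulmx1 mul1mx.
- exact: comb.
- by apply/comb_BA_swapAB/comb_AB_no_past => -[].
Qed.

Lemma direct_sum_BA (P AI AO BI BO F : finType) (U : op C (AI * BI * F) (P * AO * BO)) :
  unitary U ->
  (forall m (U2 : op C (AI * BI * 'I_m) ('I_#|P| * AO * BO)), comb_BA (choi_vec_op U2)) ->
  direct_sum_of_combs U.
Proof.
move=> uU comb; apply: (direct_sum_of_blocks uU (decomp_mxC (decomp_mx_full C #|P|))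
  (decomp_mxC (decomp_mx_full C #|F|))).
- by move=> e t; rewrite !mul0mx mulmx0.
- by apply: comb_AB_no_past => -[].
- exact: comb.
Qed.

Lemma inhabited_or_empty (T : finType) : T + (T -> False).
Proof. by case: (pickP (fun _ : T => true)) => [t _|no]; [left | right=> t; move: (no t)]. Qed.

(** The second alternative supplies a state for [kraus_replace]; when both spaces are empty, the
    guard lets the zero vector serve. *)
Lemma state_or_no_channel (I O : finType) :
  I * (O -> False) + {s : O -> C | I -> unit_vec s}.
Proof.
have [o|noO] := inhabited_or_empty O.
  by right; exists (fun t => (t == o)%:R) => _; apply: unit_vec_delta.
by have [i|noI] := inhabited_or_empty I; [left | right; exists (fun=> 0) => /noI].
Qed.

Lemma pairing_empty (X : finType) (c e : op C X X) : (X -> False) -> pairing c e = 0.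
Proof. by move=> noX; apply: big1 => x; case: (noX x). Qed.

(** Discard-and-prepare channels give the value 1 at the diagonal entry [p], whereas a sum over an
    empty slot would be 0. *)
Lemma superchannel_inhabited (P AI AO BI BO F : finType) (W : op6 C P AI AO BI BO F)
    (p : P) (s : AO -> C) (s' : BO -> C) :
  superchannel W -> (AI -> unit_vec s) -> (BI -> unit_vec s') ->
  ~ (AI * AO -> False) /\ ~ (BI * BO -> False).
Proof.
move=> sW us us'; have := superchannel_kraus p p sW (kraus_replace us) (kraus_replace us').
rewrite eqxx => one; split=> no.
  by move/eqP: one; rewrite pairing_empty // eq_sym oner_eq0.
by move/eqP: one; rewrite pairing_exchange pairing_empty // eq_sym oner_eq0.
Qed.

End Assembly.

Theorem theorem4 (C : numClosedFieldType) (P AI AO BI BO F : finType)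
  (U : op C (AI * BI * F) (P * AO * BO)) :
  unitary U -> pure_superchannel (choi_vec_op U) ->
  exists (p1 p2 f1 f2 : nat)
    (V1 : op C P 'I_p1) (V2 : op C P 'I_p2)
    (W1 : op C F 'I_f1) (W2 : op C F 'I_f2)
    (U1 : op C (AI * BI * 'I_f1) ('I_p1 * AO * BO))
    (U2 : op C (AI * BI * 'I_f2) ('I_p2 * AO * BO)),
    [/\ orth_decomp V1 V2,
        orth_decomp W1 W2,
        unitary U1 /\ comb_AB (choi_vec_op U1),
        unitary U2 /\ comb_BA (choi_vec_op U2)
      & restricts U V1 W1 U1 /\ restricts U V2 W2 U2].
Proof.
move=> uU [sW _]; rewrite -/(direct_sum_of_combs U).
have [p|noP] := inhabited_or_empty P; last first.
  by apply: direct_sum_AB => // m U1; apply/comb_AB_no_past/ord_card_empty.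
have [[a noAO]|[s us]] := state_or_no_channel C AI AO.
  by apply: direct_sum_AB => // m U1; apply: comb_AB_no_output.
have [[b noBO]|[s' us']] := state_or_no_channel C BI BO.
  by apply: direct_sum_BA => // m U2; apply/comb_BA_swapAB/comb_AB_no_output.
(* P is inhabited and both slots admit test channels, so basis elements of all four slot spaces
   exist and can serve as reference indices. *)
have [inhA inhB] := superchannel_inhabited p sW us us'.
have [[a x]|//] := inhabited_or_empty (AI * AO)%type.
have [[b y]|//] := inhabited_or_empty (BI * BO)%type.
have [p1 [p2 [f1 [f2 [V1 [V2 [W1 [W2 [dV dW u1 c1 c2]]]]]]]]] :=
  blocks_causal_decomposition a b x y uU sW.
apply: (direct_sum_of_blocks uU dV dW u1); first exact: comb_AB_of_blocks.
by apply: comb_BA_swapAB; apply: comb_AB_of_blocks c2.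
Qed.
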